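(* Let $\delta\in\{1,-1,0\}$ and let $\mathbf{M}_\delta$ be a timelike Weingarten rotational surface in $\mathbb{S}^3_1$ (spherical for $\delta=1$, hyperbolic of the first kind for $\delta=-1$, parabolic for $\delta=0$), with profile curve parameterized by the principal curvature $\lambda$, whose principal curvatures satisfy $\kappa=\lambda-2H$. Let $$\Phi_{-1}(\lambda,\delta)=\phi_0\pm\frac{c^2}{\sqrt2}\int\frac{\lambda\,d\lambda}{\sqrt{H-\lambda}\,(c^2-2\delta(H-\lambda))\sqrt{(\lambda^2+1)c^2-2\delta(H-\lambda)}}$$ with constants $\phi_0$, $H$ and $c>0$. Then the coordinate functions of the profile curve of $\mathbf{M}_\delta$ with constant mean curvature $H$, parameterized with respect to $\lambda$, are given by one of the following cases. 1. For $\delta=1$: (a) $y(\lambda)=\frac{c}{\sqrt{2(H-\lambda)}}$, $z(\lambda)=\sqrt{1-y^2(\lambda)}\cosh\Phi_{-1}(\lambda,1)$, $w(\lambda)=\sqrt{1-y^2(\lambda)}\sinh\Phi_{-1}(\lambda,1)$ where i) $\lambda<\frac{-1-\sqrt{1+2Hc^2-c^4}}{c^2}$ or $\frac{-1+\sqrt{1+2Hc^2-c^4}}{c^2}<\lambda<H-\frac{c^2}{2}$ when $H>\frac12\left(c^2-\frac1{c^2}\right)$; ii) $\lambda<H-\frac{c^2}{2}$ when $H\le\frac12\left(c^2-\frac1{c^2}\right)$; (b) $y(\lambda)=\frac{c}{\sqrt{2(H-\lambda)}}$, $z(\lambda)=\sqrt{y^2(\lambda)-1}\sinh\Phi_{-1}(\lambda,1)$,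 $w(\lambda)=\sqrt{y^2(\lambda)-1}\cosh\Phi_{-1}(\lambda,1)$ where $H-\frac{c^2}{2}<\lambda<H$. 2. For $\delta=-1$: $w(\lambda)=\frac{c}{\sqrt{2(H-\lambda)}}$, $x(\lambda)=\sqrt{1+w^2(\lambda)}\cos\Phi_{-1}(\lambda,-1)$, $y(\lambda)=\sqrt{1+w^2(\lambda)}\sin\Phi_{-1}(\lambda,-1)$ where $\lambda<H$. 3. For $\delta=0$: $z(\lambda)=\frac{c}{\sqrt{2(H-\lambda)}}$, $x(\lambda)=\Phi_{-1}(\lambda,0)z(\lambda)$, $w(\lambda)=\frac{1-x^2(\lambda)}{2z(\lambda)}$ where $\lambda<H$.
   Context: $\mathbb{E}^4_1$ is 4-dimensional Minkowski space with metric $\tilde g$, and $\mathbb{S}^3_1=\{\mathbf{x}\in\mathbb{E}^4_1:\tilde g(\mathbf{x},\mathbf{x})=1\}$ is de Sitter space. For $\delta=\pm1$ coordinates are used in which $\tilde g(\mathbf{x},\mathbf{y})=x_1y_1+x_2y_2+x_3y_3-x_4y_4$; for $\delta=0$, coordinates in which $\tilde g(\mathbf{x},\mathbf{y})=x_1y_1+x_2y_2+x_3y_4+x_4y_3$. Rotational surfaces $\mathbf{M}_\delta$, with $u\in J$ the arc length parameter of the profile curve $C$, $\tilde g(C',C')=\varepsilon=\pm1$, $'=d/du$: - Spherical, $\mathbf{M}_1$: $r(u,v)=(y\sin v,y\cos v,z,w)$, $v\in[0,2\pi]$, $y>0$, $y^2+z^2-w^2=1$, $y'^2+z'^2-w'^2=\varepsilon$;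 induced metric $\varepsilon du^2+y^2dv^2$; $z',w'$ nonzero. - Hyperbolic of the first kind, $\mathbf{M}_{-1}$: $r(u,v)=(x,y,w\sinh v,w\cosh v)$, $v\in\mathbb{R}$, $w>0$, $x^2+y^2-w^2=1$, $x'^2+y'^2-w'^2=\varepsilon$; induced metric $\varepsilon du^2+w^2dv^2$; $x',y'$ nonzero. - Parabolic, $\mathbf{M}_0$: $r(u,v)=(x,vz,z,-\tfrac12v^2z+w)$, $v\in\mathbb{R}$, $z>0$, $2zw+x^2=1$, $2z'w'+x'^2=\varepsilon$; induced metric $\varepsilon du^2+z^2dv^2$; $x',z'$ nonzero. Here $x,y,z,w$ are functions of $u$, and the surfaces are assumed not contained in a hyperplane of $\mathbb{E}^4_1$. The surface is spacelike if $\varepsilon=1$ and timelike if $\varepsilon=-1$. ''Parameterized with respect to $\lambda$'' means $\lambda$ replaces $u$ as parameter of the profile curve; the coordinate functions become functions of $\lambda$. Principal curvatures: with $N$ a unit normal field of the surface in $\mathbb{S}^3_1$, $\kappa=\tilde g(r_{uu},N)$ and $\lambda=\tilde g(r_{vv},N)/\tilde g(r_v,r_v)$; the eigenvalues of the shape operator are $\varepsilon\kappa,\lambda$, and the mean curvature is half its trace, $H=\frac12(\varepsilon\kappa+\lambda)$. Standing assumption: $\lambda$ ranges over an open interval on which $H-\lambda>0$, $c^2-2\delta(H-\lambda)\ne0$ and $(\lambda^2+1)c^2-2\delta(H-\lambda)>0$. The integral denotes an antiderivative in $\lambda$.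
   Formalization: For δ=1 the cosh coordinate (z in case (a), w in case (b)) carries a constant sign ±1, since the printed formulas force z>0 resp. w>0, while reflecting z to −z or w to −w preserves all hypotheses. *)

(* Defs.v *)
(* Stdlib reals with Coquelicot's total derivative operators. *)
From Stdlib Require Import Reals.
From Coquelicot Require Import Coquelicot.
Open Scope R_scope.

Record E4 := Pt { x1 : R; x2 : R; x3 : R; x4 : R }.

Definition origin : E4 := Pt 0 0 0 0.

(* The three types correspond to delta = 1, -1, 0. *)
Inductive rotation_type := Spherical | Hyperbolic | Parabolic.

Definition delta (k : rotation_type) : R :=
  match k with Spherical => 1 | Hyperbolic => -1 | Parabolic => 0 end.

(* The Minkowski metric; for delta = 0 it is written in pseudo-orthonormal
   coordinates in which the third and fourth axes are null. *)
Definition g (k : rotation_type) (p q : E4) : R :=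
  match k with
  | Spherical | Hyperbolic =>
      x1 p * x1 q + x2 p * x2 q + x3 p * x3 q - x4 p * x4 q
  | Parabolic =>
      x1 p * x1 q + x2 p * x2 q + x3 p * x4 q + x4 p * x3 q
  end.

Definition in_dS3 (k : rotation_type) (p : E4) : Prop := g k p p = 1.

Definition dvec (f : R -> E4) (t : R) : E4 :=
  Pt (Derive (fun s => x1 (f s)) t) (Derive (fun s => x2 (f s)) t)
     (Derive (fun s => x3 (f s)) t) (Derive (fun s => x4 (f s)) t).

Definition d2vec (f : R -> E4) (t : R) : E4 :=
  Pt (Derive_n (fun s => x1 (f s)) 2 t) (Derive_n (fun s => x2 (f s)) 2 t)
     (Derive_n (fun s => x3 (f s)) 2 t) (Derive_n (fun s => x4 (f s)) 2 t).

Definition is_open_interval (J : R -> Prop) : Prop :=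
  exists a b : Rbar, Rbar_lt a b /\
    forall t : R, J t <-> (Rbar_lt a t /\ Rbar_lt t b).

Definition smooth_on (J : R -> Prop) (f : R -> R) : Prop :=
  forall (n : nat) (t : R), J t -> ex_derive_n f n t.

Definition smooth_curve_on (J : R -> Prop) (f : R -> E4) : Prop :=
  smooth_on J (fun t => x1 (f t)) /\ smooth_on J (fun t => x2 (f t)) /\
  smooth_on J (fun t => x3 (f t)) /\ smooth_on J (fun t => x4 (f t)).

(* The profile curve has coordinates (0,y,z,w), (x,y,0,w), (x,0,z,w) in the
   three types, always listed in the order (x1,x2,x3,x4) = (x,y,z,w). *)
Definition in_profile_space (k : rotation_type) (p : E4) : Prop :=
  match k with
  | Spherical => x1 p = 0
  | Hyperbolic => x3 p = 0
  | Parabolic => x2 p = 0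
  end.

(* The induced metric is eps du^2 + (radius)^2 dv^2. *)
Definition radius (k : rotation_type) (p : E4) : R :=
  match k with
  | Spherical => x2 p
  | Hyperbolic => x4 p
  | Parabolic => x3 p
  end.

Definition v_range (k : rotation_type) (v : R) : Prop :=
  match k with
  | Spherical => 0 <= v <= 2 * PI
  | Hyperbolic | Parabolic => True
  end.

Definition surface (k : rotation_type) (gamma : R -> E4) (u v : R) : E4 :=
  match k with
  | Spherical =>
      Pt (x2 (gamma u) * sin v) (x2 (gamma u) * cos v)
         (x3 (gamma u)) (x4 (gamma u))
  | Hyperbolic =>
      Pt (x1 (gamma u)) (x2 (gamma u))
         (x4 (gamma u) * sinh v) (x4 (gamma u) * cosh v)
  | Parabolic =>
      Pt (x1 (gamma u)) (v * x3 (gamma u)) (x3 (gamma u))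
         (- (1 / 2) * v ^ 2 * x3 (gamma u) + x4 (gamma u))
  end.

Definition nonzero_on (J : R -> Prop) (f : R -> R) : Prop :=
  exists u, J u /\ f u <> 0.

(* z', w' (spherical), x', y' (hyperbolic), x', z' (parabolic). *)
Definition nonzero_derivatives
    (k : rotation_type) (J : R -> Prop) (gamma : R -> E4) : Prop :=
  let x' u := x1 (dvec gamma u) in
  let y' u := x2 (dvec gamma u) in
  let z' u := x3 (dvec gamma u) in
  let w' u := x4 (dvec gamma u) in
  match k with
  | Spherical => nonzero_on J z' /\ nonzero_on J w'
  | Hyperbolic => nonzero_on J x' /\ nonzero_on J y'
  | Parabolic => nonzero_on J x' /\ nonzero_on J z'
  end.

Definition in_hyperplane
    (k : rotation_type) (J : R -> Prop) (gamma : R -> E4) : Prop :=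
  exists (a : E4) (b : R), a <> origin /\
    forall u v, J u -> v_range k v -> g k a (surface k gamma u v) = b.

Definition rotational_surface
    (k : rotation_type) (eps : R) (J : R -> Prop) (gamma : R -> E4) : Prop :=
  is_open_interval J /\
  smooth_curve_on J gamma /\
  (forall u, J u ->
     in_profile_space k (gamma u) /\
     0 < radius k (gamma u) /\
     in_dS3 k (gamma u) /\
     g k (dvec gamma u) (dvec gamma u) = eps) /\
  nonzero_derivatives k J gamma /\
  ~ in_hyperplane k J gamma.

Definition r_u k gamma u v : E4 := dvec (fun s => surface k gamma s v) u.
Definition r_v k gamma u v : E4 := dvec (fun s => surface k gamma u s) v.
Definition r_uu k gamma u v : E4 := d2vec (fun s => surface k gamma s v) u.
Definition r_vv k gamma u v : E4 := d2vec (fun s => surface k gamma u s) v.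

(* The tangent space of the ambient E4 at a point of the surface has the
   orthogonal basis r, r_u, r_v, N, and the metric has signature (3,1); hence a
   unit normal satisfies g(N,N) = - eps. *)
Definition unit_normal_field (k : rotation_type) (eps : R) (J : R -> Prop)
    (gamma : R -> E4) (N : R -> R -> E4) : Prop :=
  let D (p : R * R) := J (fst p) /\ v_range k (snd p) in
  (continuous_on D (fun p : R * R => x1 (N (fst p) (snd p))) /\
   continuous_on D (fun p : R * R => x2 (N (fst p) (snd p))) /\
   continuous_on D (fun p : R * R => x3 (N (fst p) (snd p))) /\
   continuous_on D (fun p : R * R => x4 (N (fst p) (snd p)))) /\
  forall u v, J u -> v_range k v ->
    g k (N u v) (N u v) = - eps /\
    g k (N u v) (surface k gamma u v) = 0 /\
    g k (N u v) (r_u k gamma u v) = 0 /\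
    g k (N u v) (r_v k gamma u v) = 0.

(* The eigenvalues of the shape operator are eps * curv_kappa, curv_lambda. *)
Definition curv_kappa (k : rotation_type) (gamma : R -> E4) (N : R -> R -> E4)
    (u v : R) : R :=
  g k (r_uu k gamma u v) (N u v).

Definition curv_lambda (k : rotation_type) (gamma : R -> E4) (N : R -> R -> E4)
    (u v : R) : R :=
  g k (r_vv k gamma u v) (N u v) / g k (r_v k gamma u v) (r_v k gamma u v).

Definition mean_curvature (k : rotation_type) (eps : R) (gamma : R -> E4)
    (N : R -> R -> E4) (u v : R) : R :=
  1 / 2 * (eps * curv_kappa k gamma N u v + curv_lambda k gamma N u v).

(* u = mu(l) is a regular change of parameter from l in I to u in J, and l is
   the principal curvature lambda at the parameter u = mu(l). *)
Definition parameterized_by_lambda (k : rotation_type) (J I : R -> Prop)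
    (gamma : R -> E4) (N : R -> R -> E4) (mu : R -> R) : Prop :=
  is_open_interval I /\
  smooth_on I mu /\
  (forall l, I l -> J (mu l) /\ Derive mu l <> 0) /\
  (forall u, J u -> exists l, I l /\ mu l = u) /\
  (forall l v, I l -> v_range k v -> curv_lambda k gamma N (mu l) v = l).

Definition admissible (k : rotation_type) (H c : R) (I : R -> Prop) : Prop :=
  forall l, I l ->
    c ^ 2 - 2 * delta k * (H - l) <> 0 /\
    0 < (l ^ 2 + 1) * c ^ 2 - 2 * delta k * (H - l).

Definition Phi_integrand (k : rotation_type) (H c l : R) : R :=
  l / (sqrt (H - l) * (c ^ 2 - 2 * delta k * (H - l)) *
       sqrt ((l ^ 2 + 1) * c ^ 2 - 2 * delta k * (H - l))).

(* The functions denoted Phi_{-1}(l, delta): a constant plus or minus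
   c^2 / sqrt 2 times an antiderivative on I. *)
Definition is_Phi (k : rotation_type) (H c : R) (I : R -> Prop) (Phi : R -> R)
  : Prop :=
  exists (phi0 s : R) (F : R -> R),
    (s = 1 \/ s = -1) /\
    (forall l, I l -> is_derive F l (Phi_integrand k H c l)) /\
    forall l, I l -> Phi l = phi0 + s * (c ^ 2 / sqrt 2) * F l.

(* In the two spherical cases the curve lies on one of the two branches of a
   hyperbola, which the reflections z |-> -z, respectively w |-> -w, of the
   ambient space exchange; the sign s records the branch. *)
Definition spherical_case_a (H c : R) (I : R -> Prop) (Phi : R -> R)
    (gamma : R -> E4) : Prop :=
  (exists s : R, (s = 1 \/ s = -1) /\
    forall l, I l ->
      x2 (gamma l) = c / sqrt (2 * (H - l)) /\
      x3 (gamma l) = s * (sqrt (1 - x2 (gamma l) ^ 2) * cosh (Phi l)) /\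
      x4 (gamma l) = sqrt (1 - x2 (gamma l) ^ 2) * sinh (Phi l)) /\
  ((H > 1 / 2 * (c ^ 2 - 1 / c ^ 2) /\
    forall l, I l ->
      l < (- 1 - sqrt (1 + 2 * H * c ^ 2 - c ^ 4)) / c ^ 2 \/
      (- 1 + sqrt (1 + 2 * H * c ^ 2 - c ^ 4)) / c ^ 2 < l < H - c ^ 2 / 2) \/
   (H <= 1 / 2 * (c ^ 2 - 1 / c ^ 2) /\
    forall l, I l -> l < H - c ^ 2 / 2)).

Definition spherical_case_b (H c : R) (I : R -> Prop) (Phi : R -> R)
    (gamma : R -> E4) : Prop :=
  (exists s : R, (s = 1 \/ s = -1) /\
    forall l, I l ->
      x2 (gamma l) = c / sqrt (2 * (H - l)) /\
      x3 (gamma l) = sqrt (x2 (gamma l) ^ 2 - 1) * sinh (Phi l) /\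
      x4 (gamma l) = s * (sqrt (x2 (gamma l) ^ 2 - 1) * cosh (Phi l))) /\
  (forall l, I l -> H - c ^ 2 / 2 < l < H).

Definition hyperbolic_case (H c : R) (I : R -> Prop) (Phi : R -> R)
    (gamma : R -> E4) : Prop :=
  forall l, I l ->
    x4 (gamma l) = c / sqrt (2 * (H - l)) /\
    x1 (gamma l) = sqrt (1 + x4 (gamma l) ^ 2) * cos (Phi l) /\
    x2 (gamma l) = sqrt (1 + x4 (gamma l) ^ 2) * sin (Phi l) /\
    l < H.

Definition parabolic_case (H c : R) (I : R -> Prop) (Phi : R -> R)
    (gamma : R -> E4) : Prop :=
  forall l, I l ->
    x3 (gamma l) = c / sqrt (2 * (H - l)) /\
    x1 (gamma l) = Phi l * x3 (gamma l) /\
    x4 (gamma l) = (1 - x1 (gamma l) ^ 2) / (2 * x3 (gamma l)) /\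
    l < H.

(* Main.v *)
(* Along the profile curve gamma, the vectors gamma, gamma' and the normal n at
   v = 0 form an orthonormal frame of a three-dimensional Lorentz space, and the
   radius rho of the rotation is the product with a fixed vector e, g(e,e) = delta.
   The definition of lambda says that n has radius - lambda rho, while
   gamma'' = gamma + kappa n. With D the radius of the cross product of gamma and
   gamma', and tau = 1 or -1 fixed by the side of the normal, the frame gives
     D = tau lambda rho,  D' = - tau kappa rho',  D^2 = delta + rho'^2 - rho^2.
   Put kappa = lambda - 2H and take lambda as parameter, with u = mu(lambda). The
   first two equations become 2 (H - lambda) d rho/d lambda = rho, so
   2 (H - lambda) rho^2 is a constant c^2, and the third then gives mu'^2. Finally
   the angle of the profile curve (circular, hyperbolic or parabolic) has
   u-derivative D / (rho^2 - delta) up to a constant sign, which is the integrand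
   of Phi after the change of parameter. *)
Require Import Defs.
From Stdlib Require Import Reals Lra Ranalysis5.
From Coquelicot Require Import Coquelicot.
Open Scope R_scope.

(** * Real functions on open intervals *)

Lemma open_interval_between (I : R -> Prop) (a b t : R) :
  is_open_interval I -> I a -> I b -> a <= t <= b -> I t.
Proof.
intros (x & y & _ & HI) Ha Hb [Hat Htb].
apply HI in Ha; apply HI in Hb; apply HI; split.
- apply Rbar_lt_le_trans with a; [apply Ha | exact Hat].
- apply Rbar_le_lt_trans with b; [exact Htb | apply Hb].
Qed.

Lemma open_interval_locally (I : R -> Prop) (t : R) :
  is_open_interval I -> I t -> locally t I.
Proof.
intros (x & y & _ & HI) Ht; apply HI in Ht.
apply filter_imp with (P := fun s : R => Rbar_lt x s /\ Rbar_lt s y).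
- intros s Hs; apply HI; exact Hs.
- apply filter_and.
  + apply (open_Rbar_gt' t x), Ht.
  + apply (open_Rbar_lt' t y), Ht.
Qed.

Lemma open_interval_nonempty (I : R -> Prop) :
  is_open_interval I -> exists t, I t.
Proof.
intros (x & y & Hxy & HI).
assert (Hm : exists t : R, Rbar_lt x t /\ Rbar_lt t y).
{ destruct x as [x | |]; destruct y as [y | |]; simpl in Hxy; try easy.
  - exists ((x + y) / 2); simpl; lra.
  - exists (x + 1); simpl; split; [lra | exact Logic.I].
  - exists (y - 1); simpl; split; [exact Logic.I | lra].
  - exists 0; simpl; tauto. }
destruct Hm as [t Ht]; exists t; apply HI; exact Ht.
Qed.

(** By the intermediate value theorem. The sign is returned as a factor 1 or -1, so that it can be
    multiplied into formulas: it later records the branch of a hyperbola, the side of the normal and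
    the direction of [mu]. *)
Lemma constant_sign_on (I : R -> Prop) (f : R -> R) :
  is_open_interval I ->
  (forall t, I t -> continuous f t) -> (forall t, I t -> f t <> 0) ->
  exists s, (s = 1 \/ s = -1) /\ forall t, I t -> 0 < s * f t.
Proof.
intros HI Hc Hn.
assert (no_change : forall s a b,
  (s = 1 \/ s = -1) -> I a -> I b -> a < b -> s * f a < 0 -> 0 < s * f b -> False).
{ intros s a b Hs Ha Hb Hab Hfa Hfb.
  destruct (IVT_interv (fun t => s * f t) a b) as [z [Hz Hfz]]; try easy.
  - intros t Ht; apply continuity_pt_filterlim.
    apply (continuous_scal_r s f t), Hc.
    now apply (open_interval_between I a b).
  - assert (Iz : I z) by now apply (open_interval_between I a b).
    apply (Hn z Iz).
    destruct Hs as [-> | ->]; lra. }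
destruct (open_interval_nonempty I HI) as [a Ha].
assert (Hs : exists s, (s = 1 \/ s = -1) /\ 0 < s * f a).
{ pose proof (Hn a Ha).
  destruct (Rlt_or_le 0 (f a)); [exists 1 | exists (-1)]; split; lra. }
destruct Hs as [s [Hs Hfa]]; exists s; split; [exact Hs |].
intros b Hb.
destruct (Rlt_or_le 0 (s * f b)) as [h | h]; [exact h | exfalso].
assert (Hfb : s * f b < 0).
{ pose proof (Hn b Hb); destruct Hs as [-> | ->]; lra. }
destruct (Rtotal_order a b) as [lt | [eq | gt]].
- apply (no_change (- s) a b); try lra; easy.
- subst b; lra.
- apply (no_change s b a); easy.
Qed.

Lemma constant_on (I : R -> Prop) (f : R -> R) (a b : R) :
  is_open_interval I -> (forall t, I t -> is_derive f t 0) -> I a -> I b ->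
  f a = f b.
Proof.
intros HI Hf Ha Hb.
destruct (Rtotal_order a b) as [lt | [-> | gt]]; [| reflexivity |].
- apply eq_is_derive; [| exact lt].
  intros t Ht; apply Hf; now apply (open_interval_between I a b).
- symmetry; apply eq_is_derive; [| exact gt].
  intros t Ht; apply Hf; now apply (open_interval_between I b a).
Qed.

Lemma antiderivative_on (I : R -> Prop) (f : R -> R) :
  is_open_interval I -> (forall t, I t -> continuous f t) ->
  exists F : R -> R, forall t, I t -> is_derive F t (f t).
Proof.
intros HI Hf.
destruct (open_interval_nonempty I HI) as [a Ha].
exists (RInt f a); intros t Ht.
apply is_derive_RInt with a; [| now apply Hf].
apply filter_imp with I; [| now apply open_interval_locally].
intros s Hs; apply (@RInt_correct R_CompleteNormedModule).
apply (ex_RInt_continuous (V := R_CompleteNormedModule)).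
intros z Hz; apply Hf.
destruct (Rle_dec a s) as [le | nle].
- rewrite Rmin_left, Rmax_right in Hz by easy.
  now apply (open_interval_between I a s).
- rewrite Rmin_right, Rmax_left in Hz by lra.
  now apply (open_interval_between I s a).
Qed.

Lemma point_on_circle (a b : R) :
  a ^ 2 + b ^ 2 = 1 -> exists t, a = cos t /\ b = sin t.
Proof.
intros Hab.
assert (Ha : -1 <= a <= 1) by nra.
destruct (Rle_lt_dec 0 b) as [Hb | Hb].
- exists (acos a); split; [now rewrite cos_acos |].
  rewrite sin_acos by easy.
  replace (1 - a²) with (b²) by (unfold Rsqr; nra).
  now rewrite sqrt_Rsqr.
- exists (- acos a); split; [now rewrite cos_neg, cos_acos |].
  rewrite sin_neg, sin_acos by easy.
  replace (1 - a²) with ((- b)²) by (unfold Rsqr; nra).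
  rewrite sqrt_Rsqr; lra.
Qed.

Ltac rewrite_derivatives :=
  repeat match goal with
  | |- context [Derive ?f ?t] => erewrite (is_derive_unique f t) by eassumption
  end.

(** [Phi] is the antiderivative of the angular velocity [omega] that takes at a base point an angle
    of the point there; uniqueness then replaces any choice of branches of inverse trigonometric
    functions. *)
Lemma angle_lift (I : R -> Prop) (a b a' b' omega : R -> R) :
  is_open_interval I ->
  (forall t, I t -> is_derive a t (a' t)) ->
  (forall t, I t -> is_derive b t (b' t)) ->
  (forall t, I t -> continuous omega t) ->
  (forall t, I t -> a t * b' t - b t * a' t = omega t) ->
  (forall t, I t -> a t ^ 2 + b t ^ 2 = 1) ->
  exists Phi : R -> R, forall t, I t ->
    is_derive Phi t (omega t) /\
    a t = cos (Phi t) /\ b t = sin (Phi t).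
Proof.
intros HI Ha Hb Hc Hom Hab.
destruct (open_interval_nonempty I HI) as [t0 Ht0].
destruct (antiderivative_on I _ HI Hc) as [F HF].
destruct (point_on_circle (a t0) (b t0) (Hab t0 Ht0)) as [th [Hth1 Hth2]].
pose (Phi t := F t + (th - F t0)).
assert (HPhi0 : Phi t0 = th) by (unfold Phi; ring).
assert (HPhi : forall t, I t -> is_derive Phi t (omega t)).
{ intros t Ht; unfold Phi.
  evar_last; [apply (is_derive_plus F (fun _ => th - F t0)); [now apply HF | apply is_derive_const] |].
  apply Rplus_0_r. }
assert (Haa : forall t, I t -> a t * a' t + b t * b' t = 0).
{ intros t Ht.
  assert (H1 : is_derive (fun s => a s ^ 2 + b s ^ 2) t (2 * (a t * a' t + b t * b' t))).
  { pose proof (Ha t Ht); pose proof (Hb t Ht).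
    auto_derive; [repeat split; eexists; eassumption |].
    rewrite_derivatives; ring. }
  assert (H2 : is_derive (fun s => a s ^ 2 + b s ^ 2) t 0).
  { apply is_derive_ext_loc with (fun _ => 1); [| apply (is_derive_const 1)].
    apply filter_imp with I; [| now apply open_interval_locally].
    intros s Hs; symmetry; now apply Hab. }
  apply is_derive_unique in H1; apply is_derive_unique in H2; lra. }
(* The point (a, b) rotated by - Phi is constant. *)
assert (D1 : forall t, I t ->
  is_derive (fun s => a s * cos (Phi s) + b s * sin (Phi s)) t 0).
{ intros t Ht.
  pose proof (Ha t Ht) as A; pose proof (Hb t Ht) as B; pose proof (HPhi t Ht) as P.
  auto_derive; [repeat split; eexists; eassumption |].
  rewrite_derivatives; rewrite <- (Hom t Ht).
  pose proof (Haa t Ht); pose proof (Hab t Ht).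
  (* With [omega] written out, the coefficients of sine and cosine are combinations of 1 - (a^2 +
     b^2) and a a' + b b', both zero on the unit circle. *)
  transitivity ((b' t * (1 - (a t ^ 2 + b t ^ 2)) + b t * (a t * a' t + b t * b' t)) * sin (Phi t)
    + (a' t * (1 - (a t ^ 2 + b t ^ 2)) + a t * (a t * a' t + b t * b' t)) * cos (Phi t));
  [ring | rewrite H, H0; ring]. }
assert (D2 : forall t, I t ->
  is_derive (fun s => b s * cos (Phi s) - a s * sin (Phi s)) t 0).
{ intros t Ht.
  pose proof (Ha t Ht) as A; pose proof (Hb t Ht) as B; pose proof (HPhi t Ht) as P.
  auto_derive; [repeat split; eexists; eassumption |].
  rewrite_derivatives; rewrite <- (Hom t Ht).
  pose proof (Haa t Ht); pose proof (Hab t Ht).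
  transitivity ((b' t * (1 - (a t ^ 2 + b t ^ 2)) + b t * (a t * a' t + b t * b' t)) * cos (Phi t)
    - (a' t * (1 - (a t ^ 2 + b t ^ 2)) + a t * (a t * a' t + b t * b' t)) * sin (Phi t));
  [ring | rewrite H, H0; ring]. }
exists Phi; intros t Ht; split; [now apply HPhi |].
pose proof (constant_on I _ t t0 HI D1 Ht Ht0) as E1.
pose proof (constant_on I _ t t0 HI D2 Ht Ht0) as E2.
simpl in E1, E2; rewrite HPhi0, Hth1, Hth2 in E1, E2.
pose proof (sin2_cos2 (Phi t)) as S; pose proof (sin2_cos2 th) as S0.
unfold Rsqr in S, S0; split.
(* Rotating forward again by [Phi t] recovers [a] and [b] from the two constants. *)
- transitivity (a t * (sin (Phi t) * sin (Phi t) + cos (Phi t) * cos (Phi t))).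
  { rewrite S; ring. }
  transitivity (cos (Phi t) * (a t * cos (Phi t) + b t * sin (Phi t))
    - sin (Phi t) * (b t * cos (Phi t) - a t * sin (Phi t))); [ring |].
  rewrite E1, E2.
  transitivity (cos (Phi t) * (sin th * sin th + cos th * cos th)); [ring | rewrite S0; ring].
- transitivity (b t * (sin (Phi t) * sin (Phi t) + cos (Phi t) * cos (Phi t))).
  { rewrite S; ring. }
  transitivity (sin (Phi t) * (a t * cos (Phi t) + b t * sin (Phi t))
    + cos (Phi t) * (b t * cos (Phi t) - a t * sin (Phi t))); [ring |].
  rewrite E1, E2.
  transitivity (sin (Phi t) * (sin th * sin th + cos th * cos th)); [ring | rewrite S0; ring].
Qed.
(** * Orthonormal frames in the profile space *)

(* The Lorentzian cross product of the three-dimensional space of the profile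
   curve; in every type the orientation makes its radius the determinant that
   becomes the derivative of the angle. *)
Definition cross (k : rotation_type) (p q : E4) : E4 :=
  match k with
  | Spherical =>
      Pt 0 (x3 p * x4 q - x4 p * x3 q) (x4 p * x2 q - x2 p * x4 q)
         (x3 p * x2 q - x2 p * x3 q)
  | Hyperbolic =>
      Pt (x4 p * x2 q - x2 p * x4 q) (x1 p * x4 q - x4 p * x1 q) 0
         (x1 p * x2 q - x2 p * x1 q)
  | Parabolic =>
      Pt (x4 p * x3 q - x3 p * x4 q) 0 (x3 p * x1 q - x1 p * x3 q)
         (x1 p * x4 q - x4 p * x1 q)
  end.

Definition vscale (a : R) (p : E4) : E4 :=
  Pt (a * x1 p) (a * x2 p) (a * x3 p) (a * x4 p).

Definition vadd (p q : E4) : E4 :=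
  Pt (x1 p + x1 q) (x2 p + x2 q) (x3 p + x3 q) (x4 p + x4 q).

(** The triple product, which is up to sign the determinant of the three vectors in the profile
    space. *)
Definition vol (k : rotation_type) (p q n : E4) : R := g k (cross k p q) n.

Ltac profile_coordinates k :=
  destruct k; unfold in_profile_space, vol, g, cross, vscale, vadd, delta, radius in *; simpl in *.

(** Cramer's rule: the linear dependence among four vectors of a three-dimensional space. Taking for
    [s] a vector of an orthonormal frame leaves only one cross product on the right. *)
Lemma vol_expansion (k : rotation_type) (p q n s : E4) :
  in_profile_space k p -> in_profile_space k q -> in_profile_space k n ->
  in_profile_space k s ->
  vscale (vol k p q n) s =
  vadd (vscale (g k s p) (cross k q n))
    (vadd (vscale (g k s q) (cross k n p)) (vscale (g k s n) (cross k p q))).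
Proof.
intros Hp Hq Hn Hs; profile_coordinates k; rewrite ?Hp, ?Hq, ?Hn, ?Hs; f_equal; ring.
Qed.

(** The signs are those of a timelike surface: position and normal are spacelike, and the velocity
    is timelike. *)
Record frame (k : rotation_type) (p q n : E4) : Prop := {
  frame_p : in_profile_space k p;
  frame_q : in_profile_space k q;
  frame_n : in_profile_space k n;
  frame_pp : g k p p = 1;
  frame_qq : g k q q = -1;
  frame_nn : g k n n = 1;
  frame_pq : g k p q = 0;
  frame_pn : g k p n = 0;
  frame_qn : g k q n = 0 }.

Lemma g_sym (k : rotation_type) (p q : E4) : g k p q = g k q p.
Proof. destruct k; simpl; ring. Qed.

Lemma radius_vscale (k : rotation_type) (a : R) (p : E4) :
  radius k (vscale a p) = a * radius k p.
Proof. destruct k; reflexivity. Qed.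

Lemma radius_vadd (k : rotation_type) (p q : E4) :
  radius k (vadd p q) = radius k p + radius k q.
Proof. destruct k; reflexivity. Qed.

Lemma radius_cross_sym (k : rotation_type) (p q : E4) :
  radius k (cross k q p) = - radius k (cross k p q).
Proof. destruct k; simpl; ring. Qed.

(** The square of the triple product is minus the Gram determinant, the minus sign coming from the
    Lorentz signature; for a frame the Gram matrix is diagonal with determinant -1. *)
Lemma frame_vol (k : rotation_type) (p q n : E4) :
  frame k p q n -> vol k p q n ^ 2 = 1.
Proof.
intros [Hp Hq Hn pp qq nn pq pn qn].
transitivity (- (g k p p * (g k q q * g k n n - g k q n ^ 2)
  - g k p q * (g k p q * g k n n - g k q n * g k p n)
  + g k p n * (g k p q * g k q n - g k q q * g k p n))).
- clear pp qq nn pq pn qn.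
  profile_coordinates k; rewrite ?Hp, ?Hq, ?Hn; ring.
- rewrite pp, qq, nn, pq, pn, qn; ring.
Qed.

(** Expanding the normal itself shows that the cross product of [p] and [q] is [vol k p q n] times
    [n]. The next lemma expands [q]; there g(q,q) = -1 is absorbed by exchanging the factors of the
    cross product. *)
Lemma frame_cross_radius (k : rotation_type) (p q n : E4) :
  frame k p q n -> radius k (cross k p q) = vol k p q n * radius k n.
Proof.
intros [Hp Hq Hn pp qq nn pq pn qn].
pose proof (f_equal (radius k) (vol_expansion k p q n n Hp Hq Hn Hn)) as E.
rewrite !radius_vadd, !radius_vscale, (g_sym k n p), (g_sym k n q), nn, pn, qn in E; lra.
Qed.

Lemma frame_cross_radius_normal (k : rotation_type) (p q n : E4) :
  frame k p q n -> radius k (cross k p n) = vol k p q n * radius k q.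
Proof.
intros [Hp Hq Hn pp qq nn pq pn qn].
pose proof (f_equal (radius k) (vol_expansion k p q n q Hp Hq Hn Hq)) as E.
rewrite !radius_vadd, !radius_vscale, (g_sym k q p), qq, pq, qn, (radius_cross_sym k p n) in E; lra.
Qed.

(** The left side is the squared triple product of [p], [q] and the fixed vector e, with g(e,e) =
    [delta k], whose products are radii. It equals minus the Gram determinant of these three
    vectors, which is the intermediate expression. *)
Lemma frame_cross_square (k : rotation_type) (p q n : E4) :
  frame k p q n ->
  radius k (cross k p q) ^ 2 = delta k + radius k q ^ 2 - radius k p ^ 2.
Proof.
intros [Hp Hq Hn pp qq nn pq pn qn].
transitivity (delta k * (g k p q ^ 2 - g k p p * g k q q)
  + g k p p * radius k q ^ 2 + g k q q * radius k p ^ 2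
  - 2 * g k p q * radius k p * radius k q).
- clear pp qq nn pq pn qn.
  profile_coordinates k; rewrite ?Hp, ?Hq; ring.
- rewrite pp, qq, pq; ring.
Qed.

(** The expansions of [p] and [n] identify the two cross products that survive in the expansion of
    [r]; the nonzero factor [vol] is then cancelled. *)
Lemma frame_second_derivative (k : rotation_type) (p q n r : E4) :
  frame k p q n -> in_profile_space k r -> g k r p = 1 -> g k r q = 0 ->
  r = vadd p (vscale (g k r n) n).
Proof.
intros F Hr rp rq.
pose proof (frame_vol k p q n F) as V.
destruct F as [Hp Hq Hn pp qq nn pq pn qn].
pose proof (vol_expansion k p q n r Hp Hq Hn Hr) as Er.
pose proof (vol_expansion k p q n p Hp Hq Hn Hp) as Ep.
pose proof (vol_expansion k p q n n Hp Hq Hn Hn) as En.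
rewrite rp, rq in Er; rewrite pp, pq, pn in Ep.
rewrite nn, (g_sym k n p), (g_sym k n q), pn, qn in En.
assert (V0 : vol k p q n <> 0) by nra.
revert V0 Er Ep En.
generalize (vol k p q n) (g k r n) (cross k q n) (cross k n p) (cross k p q).
intros v kap a b c V0 Er Ep En; unfold vadd, vscale in *.
injection Er; injection Ep; injection En; intros.
destruct r; f_equal; simpl in *; apply Rmult_eq_reg_l with v; auto; nra.
Qed.

Lemma frame_cross_acceleration (k : rotation_type) (p q n r : E4) :
  frame k p q n -> in_profile_space k r -> g k r p = 1 -> g k r q = 0 ->
  radius k (cross k p r) = vol k p q n * g k r n * radius k q.
Proof.
intros F Hr rp rq.
rewrite (frame_second_derivative k p q n r F Hr rp rq) at 1.
transitivity (g k r n * radius k (cross k p n)).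
- destruct k; simpl; ring.
- rewrite (frame_cross_radius_normal k p q n F); ring.
Qed.

(** * The frame along the profile curve *)

(** Unlike an equation for the total function [dvec], this relation asserts differentiability, so
    the rules of differentiation can be composed. *)
Definition is_dvec (f : R -> E4) (t : R) (p : E4) : Prop :=
  is_derive (fun s => x1 (f s)) t (x1 p) /\ is_derive (fun s => x2 (f s)) t (x2 p) /\
  is_derive (fun s => x3 (f s)) t (x3 p) /\ is_derive (fun s => x4 (f s)) t (x4 p).

Lemma is_derive_Rplus (f h : R -> R) (t a b : R) :
  is_derive f t a -> is_derive h t b -> is_derive (fun s => f s + h s) t (a + b).
Proof. exact (is_derive_plus f h t a b). Qed.

Lemma is_derive_Rminus (f h : R -> R) (t a b : R) :
  is_derive f t a -> is_derive h t b -> is_derive (fun s => f s - h s) t (a - b).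
Proof. exact (is_derive_minus f h t a b). Qed.

Lemma is_derive_Rmult (f h : R -> R) (t a b : R) :
  is_derive f t a -> is_derive h t b ->
  is_derive (fun s => f s * h s) t (a * h t + f t * b).
Proof. intros Hf Hh; exact (is_derive_mult f h t a b Hf Hh Rmult_comm). Qed.

Lemma is_derive_Rconst (c t : R) : is_derive (fun _ : R => c) t 0.
Proof. exact (is_derive_const c t). Qed.

Ltac derive_coordinates :=
  evar_last;
  [ repeat lazymatch goal with
    | |- is_derive (fun s => _ + _) _ _ => eapply is_derive_Rplus
    | |- is_derive (fun s => _ - _) _ _ => eapply is_derive_Rminus
    | |- is_derive (fun s => _ * _) _ _ => eapply is_derive_Rmult
    | |- is_derive (fun s => 0) _ _ => apply is_derive_Rconst
    | |- _ => eassumption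
    end
  | match goal with |- ?a = ?b => change (@eq R a b) end; cbn beta ].

Lemma is_derive_g (k : rotation_type) (f h : R -> E4) (t : R) (p q : E4) :
  is_dvec f t p -> is_dvec h t q ->
  is_derive (fun s => g k (f s) (h s)) t (g k p (h t) + g k (f t) q).
Proof.
intros (f1 & f2 & f3 & f4) (h1 & h2 & h3 & h4).
destruct k; simpl; derive_coordinates; ring.
Qed.

Lemma is_derive_radius (k : rotation_type) (f : R -> E4) (t : R) (p : E4) :
  is_dvec f t p -> is_derive (fun s => radius k (f s)) t (radius k p).
Proof. intros (f1 & f2 & f3 & f4); destruct k; assumption. Qed.

Lemma is_dvec_cross (k : rotation_type) (f h : R -> E4) (t : R) (p q : E4) :
  is_dvec f t p -> is_dvec h t q ->
  is_dvec (fun s => cross k (f s) (h s)) t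
    (vadd (cross k p (h t)) (cross k (f t) q)).
Proof.
intros (f1 & f2 & f3 & f4) (h1 & h2 & h3 & h4).
destruct k; refine (conj _ (conj _ (conj _ _))); simpl; derive_coordinates; ring.
Qed.

Lemma smooth_curve_dvec (J : R -> Prop) (f : R -> E4) (u : R) :
  smooth_curve_on J f -> J u -> is_dvec f u (dvec f u).
Proof.
intros (f1 & f2 & f3 & f4) Hu.
refine (conj _ (conj _ (conj _ _))); apply Derive_correct;
  [apply (f1 1%nat u Hu) | apply (f2 1%nat u Hu) | apply (f3 1%nat u Hu) | apply (f4 1%nat u Hu)].
Qed.

Lemma smooth_curve_d2vec (J : R -> Prop) (f : R -> E4) (u : R) :
  smooth_curve_on J f -> J u -> is_dvec (dvec f) u (d2vec f u).
Proof.
intros (f1 & f2 & f3 & f4) Hu.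
refine (conj _ (conj _ (conj _ _))); simpl; apply Derive_correct;
  [apply (f1 2%nat u Hu) | apply (f2 2%nat u Hu) | apply (f3 2%nat u Hu) | apply (f4 2%nat u Hu)].
Qed.

Lemma is_derive_locally_constant (J : R -> Prop) (f : R -> R) (c t l : R) :
  is_open_interval J -> (forall s, J s -> f s = c) -> J t ->
  is_derive f t l -> l = 0.
Proof.
intros HJ Hf Ht Hl.
apply is_derive_unique in Hl; rewrite <- Hl.
apply is_derive_unique, is_derive_ext_loc with (fun _ => c); [| apply (is_derive_const c)].
apply filter_imp with J; [| now apply open_interval_locally].
intros s Hs; symmetry; now apply Hf.
Qed.

Lemma is_dvec_profile_space (k : rotation_type) (J : R -> Prop) (f : R -> E4)
    (u : R) (p : E4) :
  is_open_interval J -> (forall s, J s -> in_profile_space k (f s)) -> J u ->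
  is_dvec f u p -> in_profile_space k p.
Proof.
intros HJ Hf Hu (f1 & f2 & f3 & f4).
destruct k; simpl in *;
  [ apply (is_derive_locally_constant J (fun s => x1 (f s)) 0 u)
  | apply (is_derive_locally_constant J (fun s => x3 (f s)) 0 u)
  | apply (is_derive_locally_constant J (fun s => x2 (f s)) 0 u) ]; assumption.
Qed.

(** * Derivatives of the surface at v = 0 *)

Definition rotation_velocity (k : rotation_type) (rho : R) : E4 :=
  match k with
  | Spherical => Pt rho 0 0 0
  | Hyperbolic => Pt 0 0 rho 0
  | Parabolic => Pt 0 rho 0 0
  end.

Definition rotation_acceleration (k : rotation_type) (rho : R) : E4 :=
  match k with
  | Spherical => Pt 0 (- rho) 0 0
  | Hyperbolic => Pt 0 0 0 rho
  | Parabolic => Pt 0 0 0 (- rho)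
  end.

(** At v = 0 the surface has its missing coordinate equal to 0 for every real [u]. With this
    projection the formulas for [r_u] and [r_uu] hold without restricting [u] to [J]; on [J] the
    projection is the identity. *)
Definition profile_projection (k : rotation_type) (p : E4) : E4 :=
  match k with
  | Spherical => Pt 0 (x2 p) (x3 p) (x4 p)
  | Hyperbolic => Pt (x1 p) (x2 p) 0 (x4 p)
  | Parabolic => Pt (x1 p) 0 (x3 p) (x4 p)
  end.

Lemma profile_projection_id (k : rotation_type) (p : E4) :
  in_profile_space k p -> profile_projection k p = p.
Proof. destruct k, p; simpl; intros ->; reflexivity. Qed.

Lemma surface_0 (k : rotation_type) (gamma : R -> E4) (u : R) :
  surface k gamma u 0 = profile_projection k (gamma u).
Proof.
destruct k; simpl; rewrite ?sin_0, ?cos_0, ?sinh_0, ?cosh_0; f_equal; ring.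
Qed.

Lemma r_u_0 (k : rotation_type) (gamma : R -> E4) (u : R) :
  r_u k gamma u 0 = profile_projection k (dvec gamma u).
Proof.
unfold r_u, dvec; destruct k; simpl; f_equal;
  first [ rewrite (Derive_ext _ (fun _ => 0));
          [apply Derive_const | intros s; rewrite ?sin_0, ?sinh_0; ring]
        | apply Derive_ext; intros s; rewrite ?cos_0, ?cosh_0; ring ].
Qed.

Lemma r_uu_0 (k : rotation_type) (gamma : R -> E4) (u : R) :
  r_uu k gamma u 0 = profile_projection k (d2vec gamma u).
Proof.
unfold r_uu, d2vec; destruct k; unfold surface, profile_projection;
  cbn [x1 x2 x3 x4]; f_equal;
  first [ rewrite (Derive_n_ext _ (fun _ => 0));
          [apply (Derive_n_const 1) | intros s; rewrite ?sin_0, ?sinh_0; ring]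
        | apply Derive_n_ext; intros s; rewrite ?cos_0, ?cosh_0; ring ].
Qed.

Lemma is_derive_sinh (t : R) : is_derive sinh t (cosh t).
Proof. apply is_derive_Reals, derivable_pt_lim_sinh. Qed.

Lemma is_derive_cosh (t : R) : is_derive cosh t (sinh t).
Proof. apply is_derive_Reals, derivable_pt_lim_cosh. Qed.

Lemma second_derivative_at (f f' : R -> R) (t l : R) :
  (forall s, is_derive f s (f' s)) -> is_derive f' t l -> Derive_n f 2 t = l.
Proof.
intros Hf Hl; simpl.
apply is_derive_unique, is_derive_ext with f'; [| exact Hl].
intros s; symmetry; apply is_derive_unique, Hf.
Qed.

Lemma r_v_0 (k : rotation_type) (gamma : R -> E4) (u : R) :
  r_v k gamma u 0 = rotation_velocity k (radius k (gamma u)).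
Proof.
unfold r_v, dvec; destruct k; simpl; f_equal;
  lazymatch goal with
  | |- Derive (fun _ => ?c) _ = _ => apply Derive_const
  | |- _ => apply is_derive_unique
  end.
- auto_derive; [easy | rewrite cos_0; ring].
- auto_derive; [easy | rewrite sin_0; ring].
- evar_last; [apply is_derive_scal, is_derive_sinh | rewrite cosh_0; apply Rmult_1_r].
- evar_last; [apply is_derive_scal, is_derive_cosh | rewrite sinh_0; apply Rmult_0_r].
- auto_derive; [easy | ring].
- auto_derive; [easy | ring].
Qed.

Lemma r_vv_0 (k : rotation_type) (gamma : R -> E4) (u : R) :
  r_vv k gamma u 0 = rotation_acceleration k (radius k (gamma u)).
Proof.
unfold r_vv, d2vec, surface; destruct k; cbn [x1 x2 x3 x4 rotation_acceleration radius]; f_equal;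
  lazymatch goal with
  | |- Derive_n (fun _ => ?c) _ _ = _ => apply (Derive_n_const 1)
  | |- _ => idtac
  end.
- apply second_derivative_at with (fun s => x2 (gamma u) * cos s).
  + intros s; auto_derive; [easy | ring].
  + auto_derive; [easy | rewrite sin_0; ring].
- apply second_derivative_at with (fun s => - x2 (gamma u) * sin s).
  + intros s; auto_derive; [easy | ring].
  + auto_derive; [easy | rewrite cos_0; ring].
- apply second_derivative_at with (fun s => x4 (gamma u) * cosh s).
  + intros s; apply is_derive_scal, is_derive_sinh.
  + evar_last; [apply is_derive_scal, is_derive_cosh | rewrite sinh_0; apply Rmult_0_r].
- apply second_derivative_at with (fun s => x4 (gamma u) * sinh s).
  + intros s; apply is_derive_scal, is_derive_cosh.
  + evar_last; [apply is_derive_scal, is_derive_sinh | rewrite cosh_0; apply Rmult_1_r].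
- apply second_derivative_at with (fun _ => x3 (gamma u)).
  + intros s; auto_derive; [easy | ring].
  + apply is_derive_Rconst.
- apply second_derivative_at with (fun s => - s * x3 (gamma u)).
  + intros s; auto_derive; [easy | field].
  + auto_derive; [easy | ring].
Qed.

Lemma v_range_0 (k : rotation_type) : v_range k 0.
Proof. pose proof PI_RGT_0; destruct k; simpl; try exact Logic.I; lra. Qed.

Section ProfileFrame.

Context {k : rotation_type} {J : R -> Prop} {gamma : R -> E4} {N : R -> R -> E4}.
Hypothesis surf : rotational_surface k (-1) J gamma.
Hypothesis normal : unit_normal_field k (-1) J gamma N.

Let HJ : is_open_interval J := proj1 surf.
Let smooth : smooth_curve_on J gamma := proj1 (proj2 surf).
Let unit_speed := proj1 (proj2 (proj2 surf)).

Lemma dvec_profile_space (u : R) : J u -> in_profile_space k (dvec gamma u).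
Proof.
intros Hu; apply (is_dvec_profile_space k J gamma u); auto.
- intros s Hs; apply unit_speed, Hs.
- now apply (smooth_curve_dvec J).
Qed.

Lemma d2vec_profile_space (u : R) : J u -> in_profile_space k (d2vec gamma u).
Proof.
intros Hu; apply (is_dvec_profile_space k J (dvec gamma) u); auto.
- exact dvec_profile_space.
- now apply (smooth_curve_d2vec J).
Qed.

Lemma curve_frame (u : R) : J u -> frame k (gamma u) (dvec gamma u) (N u 0).
Proof.
intros Hu.
destruct (unit_speed u Hu) as (Hp & Hr & Hg & Hq).
destruct (proj2 normal u 0 Hu (v_range_0 k)) as (nn & np & nq & nv).
rewrite surface_0, (profile_projection_id _ _ Hp) in np.
rewrite r_u_0, (profile_projection_id _ _ (dvec_profile_space u Hu)) in nq.
rewrite r_v_0 in nv.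
split; auto; try (rewrite g_sym; assumption).
- now apply dvec_profile_space.
(* Orthogonality to [r_v] says that the radius times the missing coordinate of the normal vanishes,
   and the radius is positive. *)
- assert (Hn : radius k (gamma u) <> 0) by lra.
  clear - nv Hn; destruct k; simpl in *; apply Rmult_eq_reg_l with (2 := Hn); lra.
- lra.
(* Position and velocity are orthogonal by differentiating g(gamma, gamma) = 1. *)
- assert (E : g k (dvec gamma u) (gamma u) + g k (gamma u) (dvec gamma u) = 0).
  { apply (is_derive_locally_constant J (fun s => g k (gamma s) (gamma s)) 1 u); auto.
    - intros s Hs; apply (unit_speed s Hs).
    - apply is_derive_g; now apply (smooth_curve_dvec J). }
  rewrite (g_sym k (dvec gamma u)) in E; lra.
Qed.

(** At v = 0, [r_vv] is minus the radius times the fixed vector e, while g(r_v, r_v) is the square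
    of the radius. *)
Lemma curv_lambda_radius (u : R) :
  J u -> radius k (N u 0) = - curv_lambda k gamma N u 0 * radius k (gamma u).
Proof.
clear normal; intros Hu; destruct (unit_speed u Hu) as (Hp & Hr & _).
unfold curv_lambda; rewrite r_v_0, r_vv_0.
destruct k; simpl in *; field; lra.
Qed.

Lemma curv_kappa_profile (u : R) :
  J u -> curv_kappa k gamma N u 0 = g k (d2vec gamma u) (N u 0).
Proof.
intros Hu; unfold curv_kappa.
now rewrite r_uu_0, profile_projection_id by now apply d2vec_profile_space.
Qed.

(** The quantity D of the frame equations. [orientation] below is the triple product of the frame,
    hence 1 or -1. *)
Definition twist (u : R) : R := radius k (cross k (gamma u) (dvec gamma u)).

Definition orientation (u : R) : R := vol k (gamma u) (dvec gamma u) (N u 0).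

Lemma is_derive_twist (u : R) : J u ->
  is_derive twist u
    (orientation u * curv_kappa k gamma N u 0 * radius k (dvec gamma u)).
Proof.
intros Hu; rewrite (curv_kappa_profile u Hu).
pose proof (curve_frame u Hu) as F.
pose proof (smooth_curve_dvec J gamma u smooth Hu) as D1.
pose proof (smooth_curve_d2vec J gamma u smooth Hu) as D2.
(* The hypotheses on the acceleration come from differentiating g(gamma', gamma') = -1 and, for
   [E0], g(gamma, gamma') = 0. *)
assert (E1 : g k (d2vec gamma u) (dvec gamma u) = 0).
{ assert (E : g k (d2vec gamma u) (dvec gamma u) + g k (dvec gamma u) (d2vec gamma u) = 0).
  { apply (is_derive_locally_constant J (fun s => g k (dvec gamma s) (dvec gamma s)) (-1) u); auto.
    - intros s Hs; apply (unit_speed s Hs).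
    - now apply is_derive_g. }
  rewrite (g_sym k (dvec gamma u)) in E; lra. }
assert (E0 : g k (d2vec gamma u) (gamma u) = 1).
{ assert (E : g k (dvec gamma u) (dvec gamma u) + g k (gamma u) (d2vec gamma u) = 0).
  { apply (is_derive_locally_constant J (fun s => g k (gamma s) (dvec gamma s)) 0 u); auto.
    - intros s Hs; apply (frame_pq _ _ _ _ (curve_frame s Hs)).
    - now apply is_derive_g. }
  rewrite (frame_qq _ _ _ _ F), (g_sym k (gamma u)) in E; lra. }
unfold orientation.
rewrite <- (frame_cross_acceleration k _ _ _ _ F (d2vec_profile_space u Hu) E0 E1).
evar_last; [apply is_derive_radius, is_dvec_cross; eassumption |].
rewrite radius_vadd.
replace (radius k (cross k (dvec gamma u) (dvec gamma u))) with 0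
  by (destruct k; simpl; ring).
ring.
Qed.

End ProfileFrame.

(** * Polar angles of plane curves *)

Lemma sqrt_eq (a b : R) : 0 <= b -> b ^ 2 = a -> sqrt a = b.
Proof. intros Hb <-; now apply sqrt_pow2. Qed.

Lemma cosh_sinh_square (x : R) : cosh x ^ 2 - sinh x ^ 2 = 1.
Proof.
unfold cosh, sinh.
assert (E : exp x * exp (- x) = 1) by now rewrite <- exp_plus, Rplus_opp_r, exp_0.
lra.
Qed.

Lemma cosh_pos (x : R) : 0 < cosh x.
Proof. unfold cosh; pose proof (exp_pos x); pose proof (exp_pos (- x)); lra. Qed.

Lemma is_derive_Rcomp (f m : R -> R) (t a b : R) :
  is_derive f (m t) a -> is_derive m t b -> is_derive (fun s => f (m s)) t (b * a).
Proof. exact (is_derive_comp f m t a b). Qed.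

Lemma is_derive_continuous (f : R -> R) (t a : R) : is_derive f t a -> continuous f t.
Proof. intros Hf; apply (ex_derive_continuous f t); now exists a. Qed.

Ltac continuous_coordinates :=
  repeat lazymatch goal with
    | |- continuous (fun s => _ + _) _ => apply (continuous_plus (V := R_NormedModule))
    | |- continuous (fun s => _ - _) _ => apply (continuous_minus (V := R_NormedModule))
    | |- continuous (fun s => _ * _) _ => apply (continuous_mult (K := R_AbsRing))
    | |- _ => first [assumption | apply continuous_const]
    end.

(** Since a^2 > b^2, [a] never vanishes and has a constant sign [s], so one branch of the hyperbola
    is involved. There the angle is explicit, the [arcsinh] of b / sqrt(a^2 - b^2), and needs no
    integration. *)
Lemma hyperbolic_angle (I : R -> Prop) (a b a' b' : R -> R) :
  is_open_interval I ->
  (forall t, I t -> is_derive a t (a' t)) ->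
  (forall t, I t -> is_derive b t (b' t)) ->
  (forall t, I t -> 0 < a t ^ 2 - b t ^ 2) ->
  exists (Phi : R -> R) (s : R), (s = 1 \/ s = -1) /\ forall t, I t ->
    is_derive Phi t (s * (a t * b' t - b t * a' t) / (a t ^ 2 - b t ^ 2)) /\
    a t = s * (sqrt (a t ^ 2 - b t ^ 2) * cosh (Phi t)) /\
    b t = sqrt (a t ^ 2 - b t ^ 2) * sinh (Phi t).
Proof.
intros HI Ha Hb Hab.
destruct (constant_sign_on I a HI) as [s [Hs Hsa]].
- intros t Ht; apply is_derive_continuous with (a' t); now apply Ha.
- intros t Ht; pose proof (Hab t Ht); nra.
- exists (fun t => arcsinh (b t / sqrt (a t ^ 2 - b t ^ 2))), s; split; [exact Hs |].
  intros t Ht.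
  pose proof (Ha t Ht) as A; pose proof (Hb t Ht) as B.
  pose proof (Hab t Ht) as Q2; pose proof (Hsa t Ht) as S.
  assert (s2 : s ^ 2 = 1) by (destruct Hs as [-> | ->]; ring).
  assert (Q0 : 0 < sqrt (a t ^ 2 - b t ^ 2)) by now apply sqrt_lt_R0.
  assert (Q1 : sqrt (a t ^ 2 - b t ^ 2) ^ 2 = a t ^ 2 - b t ^ 2) by (apply pow2_sqrt; lra).
  assert (a0 : a t <> 0) by nra.
  split; [| split].
  (* This is the denominator in the derivative of [arcsinh]; its value is |a| / sqrt(a^2 - b^2),
     with |a| = s a. *)
  + assert (E : sqrt ((b t / sqrt (a t ^ 2 - b t ^ 2)) ^ 2 + 1)
      = s * a t / sqrt (a t ^ 2 - b t ^ 2)).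
    { apply sqrt_eq.
      - apply Rlt_le, Rdiv_lt_0_compat; assumption.
      - transitivity ((s ^ 2 * a t ^ 2) / sqrt (a t ^ 2 - b t ^ 2) ^ 2); [field; lra |].
        transitivity (b t ^ 2 / sqrt (a t ^ 2 - b t ^ 2) ^ 2 + 1); [| field; lra].
        rewrite s2, Q1; field; lra. }
    assert (D : is_derive (fun t => b t / sqrt (a t ^ 2 - b t ^ 2)) t
      ((b' t * (a t ^ 2 - b t ^ 2) - b t * (a t * a' t - b t * b' t))
        / sqrt (a t ^ 2 - b t ^ 2) ^ 3)).
    { auto_derive.
      - repeat split; try (eexists; eassumption);
          try (apply Rgt_not_eq, sqrt_lt_R0); nra.
      - rewrite_derivatives.
        replace (a t * (a t * 1) + - (b t * (b t * 1))) with (a t ^ 2 - b t ^ 2) by ring.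
        revert Q0 Q1; generalize (sqrt (a t ^ 2 - b t ^ 2)); intros q Q0 Q1.
        rewrite <- Q1; field; lra. }
    evar_last.
    * apply (is_derive_Rcomp arcsinh); [| exact D].
      apply is_derive_Reals, derivable_pt_lim_arcsinh.
    * rewrite E.
      transitivity (s ^ 2 * (s * (a t * b' t - b t * a' t) / (a t ^ 2 - b t ^ 2)));
        [| rewrite s2; ring].
      revert Q0 Q1; generalize (sqrt (a t ^ 2 - b t ^ 2)); intros q Q0 Q1.
      replace (b' t * (a t ^ 2 - b t ^ 2) - b t * (a t * a' t - b t * b' t))
        with (a t * (a t * b' t - b t * a' t)) by ring.
      rewrite <- Q1.
      transitivity (s * (a t * b' t - b t * a' t) / q ^ 2); [| rewrite s2; field; lra].
      transitivity (s ^ 2 * (a t * b' t - b t * a' t) / (s * q ^ 2)).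
      -- rewrite s2; field; repeat split; try lra; destruct Hs; lra.
      -- field; split; try lra; destruct Hs; lra.
  + set (q := sqrt (a t ^ 2 - b t ^ 2)) in *.
    (* Both sides are nonnegative and have the same square. *)
    assert (C : q * cosh (arcsinh (b t / q)) = s * a t).
    { apply Rsqr_inj; [| lra |].
      - apply Rmult_le_pos; [lra | apply Rlt_le, cosh_pos].
      - pose proof (cosh_sinh_square (arcsinh (b t / q))) as E.
        rewrite sinh_arcsinh in E; unfold Rsqr.
        transitivity (q ^ 2 * (1 + (b t / q) ^ 2)); [rewrite <- E; ring |].
        transitivity (q ^ 2 + b t ^ 2); [field; lra |].
        rewrite Q1; transitivity (s ^ 2 * a t ^ 2); [rewrite s2 |]; ring. }
    rewrite C; transitivity (s ^ 2 * a t); [rewrite s2 |]; ring.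
  + rewrite sinh_arcsinh; field; lra.
Qed.

(** The curve is normalized to the unit circle and lifted there. In its angular velocity the terms
    with the derivative of the norm [q] cancel, leaving (a b' - b a') / (a^2 + b^2). *)
Lemma circular_angle (I : R -> Prop) (a b a' b' : R -> R) :
  is_open_interval I ->
  (forall t, I t -> is_derive a t (a' t)) ->
  (forall t, I t -> is_derive b t (b' t)) ->
  (forall t, I t -> continuous (fun s => a s * b' s - b s * a' s) t) ->
  (forall t, I t -> 0 < a t ^ 2 + b t ^ 2) ->
  exists Phi : R -> R, forall t, I t ->
    is_derive Phi t ((a t * b' t - b t * a' t) / (a t ^ 2 + b t ^ 2)) /\
    a t = sqrt (a t ^ 2 + b t ^ 2) * cos (Phi t) /\
    b t = sqrt (a t ^ 2 + b t ^ 2) * sin (Phi t).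
Proof.
intros HI Ha Hb Hc Hab.
pose (q t := sqrt (a t ^ 2 + b t ^ 2)).
assert (Hq : forall t, I t -> 0 < q t /\ q t ^ 2 = a t ^ 2 + b t ^ 2).
{ intros t Ht; pose proof (Hab t Ht); split; [now apply sqrt_lt_R0 | apply pow2_sqrt; lra]. }
assert (Hq' : forall t, I t -> is_derive q t ((a t * a' t + b t * b' t) / q t)).
{ intros t Ht; pose proof (Ha t Ht) as A; pose proof (Hb t Ht) as B.
  destruct (Hq t Ht) as [Q0 Q1].
  evar_last.
  - apply (is_derive_sqrt (fun t => a t ^ 2 + b t ^ 2)); [| now apply Hab].
    auto_derive; [repeat split; eexists; eassumption |].
    rewrite_derivatives; reflexivity.
  - fold (q t); match goal with |- ?x = ?y => change (@eq R x y) end; cbn beta; field; lra. }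
destruct (angle_lift I (fun t => a t / q t) (fun t => b t / q t)
  (fun t => (a' t * q t - a t * ((a t * a' t + b t * b' t) / q t)) / q t ^ 2)
  (fun t => (b' t * q t - b t * ((a t * a' t + b t * b' t) / q t)) / q t ^ 2)
  (fun t => (a t * b' t - b t * a' t) * / (a t ^ 2 + b t ^ 2))) as [Phi HPhi]; auto.
- intros t Ht; destruct (Hq t Ht); apply is_derive_div; auto; lra.
- intros t Ht; destruct (Hq t Ht); apply is_derive_div; auto; lra.
- intros t Ht; pose proof (Ha t Ht) as A; pose proof (Hb t Ht) as B.
  apply (continuous_mult (K := R_AbsRing) _ (fun s => / (a s ^ 2 + b s ^ 2))); [now apply Hc |].
  apply (ex_derive_continuous (K := R_AbsRing) (V := R_NormedModule)).
  auto_derive; repeat split; try (eexists; eassumption).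
  pose proof (Hab t Ht); lra.
- intros t Ht; destruct (Hq t Ht) as [Q0 Q1]; rewrite <- Q1; field; lra.
- intros t Ht; destruct (Hq t Ht) as [Q0 Q1].
  transitivity ((a t ^ 2 + b t ^ 2) / q t ^ 2); [field; lra |].
  rewrite <- Q1; field; lra.
- exists Phi; intros t Ht; destruct (HPhi t Ht) as (D & C & S).
  destruct (Hq t Ht) as [Q0 Q1].
  split; [exact D |]; rewrite <- C, <- S; fold (q t); split; field; lra.
Qed.

(** * The principal curvature as parameter *)

(** The normal is continuous only relative to its domain, and v = 0 is an endpoint of that domain in
    the spherical type. The slice stays inside the domain, so the restriction is continuous in the
    ordinary sense. *)
Lemma continuous_on_slice (D : R * R -> Prop) (f : R * R -> R) (mu : R -> R)
    (t v : R) :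
  continuous_on D f -> D (mu t, v) -> continuous mu t ->
  locally t (fun s => D (mu s, v)) -> continuous (fun s => f (mu s, v)) t.
Proof.
intros Hf Hd Hmu HD P HP.
destruct (Hf (mu t, v) Hd P HP) as [eps Heps].
apply filter_imp with (2 := filter_and _ _ HD
  (Hmu (ball (mu t) eps) (locally_ball (mu t) eps))).
intros s [Ds Bs]; apply Heps; [| exact Ds].
split; [exact Bs | apply ball_center].
Qed.

Section Reparameterization.

Context {k : rotation_type} {H : R} {J I : R -> Prop} {gamma : R -> E4}
  {N : R -> R -> E4} {mu : R -> R}.
Hypothesis surf : rotational_surface k (-1) J gamma.
Hypothesis normal : unit_normal_field k (-1) J gamma N.
Hypothesis weingarten : forall u v, J u -> v_range k v ->
  curv_kappa k gamma N u v = curv_lambda k gamma N u v - 2 * H.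
Hypothesis param : parameterized_by_lambda k J I gamma N mu.
Hypothesis Hlambda : forall l, I l -> 0 < H - l.

Let HI : is_open_interval I := proj1 param.

Lemma mu_in (l : R) : I l -> J (mu l).
Proof. intros Hl; apply (proj1 (proj2 (proj2 param)) l Hl). Qed.

Lemma curv_lambda_mu (l : R) : I l -> curv_lambda k gamma N (mu l) 0 = l.
Proof. intros Hl; apply (proj2 (proj2 (proj2 (proj2 param))) l 0 Hl (v_range_0 k)). Qed.

Lemma is_derive_mu (l : R) : I l -> is_derive mu l (Derive mu l).
Proof. intros Hl; apply Derive_correct, (proj1 (proj2 param) 1%nat l Hl). Qed.

Lemma continuous_Derive_mu (l : R) : I l -> continuous (Derive mu) l.
Proof.
intros Hl; apply (ex_derive_continuous (K := R_AbsRing) (V := R_NormedModule)).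
exact (proj1 (proj2 param) 2%nat l Hl).
Qed.

Lemma is_dvec_comp (f : R -> E4) (l : R) (p : E4) :
  I l -> is_dvec f (mu l) p ->
  is_dvec (fun s => f (mu s)) l (vscale (Derive mu l) p).
Proof.
intros Hl (f1 & f2 & f3 & f4); pose proof (is_derive_mu l Hl) as Hmu.
refine (conj _ (conj _ (conj _ _))).
- now apply (is_derive_Rcomp (fun s => x1 (f s))).
- now apply (is_derive_Rcomp (fun s => x2 (f s))).
- now apply (is_derive_Rcomp (fun s => x3 (f s))).
- now apply (is_derive_Rcomp (fun s => x4 (f s))).
Qed.

Let is_dvec_gamma (l : R) (Hl : I l) :
  is_dvec gamma (mu l) (dvec gamma (mu l)) :=
  smooth_curve_dvec J gamma (mu l) (proj1 (proj2 surf)) (mu_in l Hl).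

Lemma is_dvec_gamma_mu (l : R) : I l ->
  is_dvec (fun s => gamma (mu s)) l (vscale (Derive mu l) (dvec gamma (mu l))).
Proof. intros Hl; apply is_dvec_comp; auto. Qed.

Let is_dvec_dgamma (l : R) (Hl : I l) :
  is_dvec (dvec gamma) (mu l) (d2vec gamma (mu l)) :=
  smooth_curve_d2vec J gamma (mu l) (proj1 (proj2 surf)) (mu_in l Hl).

Lemma continuous_orientation (l : R) :
  I l -> continuous (fun s => @orientation k gamma N (mu s)) l.
Proof.
intros Hl.
pose proof (is_dvec_gamma_mu l Hl) as (a1 & a2 & a3 & a4).
pose proof (is_dvec_comp _ l _ Hl (is_dvec_dgamma l Hl)) as (b1 & b2 & b3 & b4).
apply is_derive_continuous in a1, a2, a3, a4, b1, b2, b3, b4.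
destruct (proj1 normal) as (n1 & n2 & n3 & n4).
pose proof (is_derive_continuous _ _ _ (is_derive_mu l Hl)) as Hmu.
assert (HD : forall s, I s -> J (mu s) /\ v_range k 0).
{ intros s Hs; split; [now apply mu_in | apply v_range_0]. }
assert (HL : locally l (fun s => J (fst (mu s, 0)) /\ v_range k (snd (mu s, 0)))).
{ apply filter_imp with (1 := HD); now apply open_interval_locally. }
pose proof (continuous_on_slice _ _ mu l 0 n1 (HD l Hl) Hmu HL) as c1.
pose proof (continuous_on_slice _ _ mu l 0 n2 (HD l Hl) Hmu HL) as c2.
pose proof (continuous_on_slice _ _ mu l 0 n3 (HD l Hl) Hmu HL) as c3.
pose proof (continuous_on_slice _ _ mu l 0 n4 (HD l Hl) Hmu HL) as c4.
cbn [fst snd] in c1, c2, c3, c4.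
unfold orientation, vol, cross, g.
generalize k; intros [ | | ]; cbn [x1 x2 x3 x4]; continuous_coordinates.
Qed.

(* The normal keeps its side, so the sign relating the angular velocity of the
   profile curve to lambda is the same on both sides of lambda = 0. *)
Lemma twist_lambda :
  exists tau, (tau = 1 \/ tau = -1) /\ forall l, I l ->
    @orientation k gamma N (mu l) = - tau /\
    @twist k gamma (mu l) = tau * l * radius k (gamma (mu l)).
Proof.
assert (Hsq : forall l, I l -> (@orientation k gamma N (mu l)) ^ 2 = 1).
{ intros l Hl; apply frame_vol; apply (curve_frame surf normal), mu_in, Hl. }
destruct (constant_sign_on I (fun l => @orientation k gamma N (mu l)) HI) as [s [Hs Hpos]].
- exact continuous_orientation.
- intros l Hl E; pose proof (Hsq l Hl) as E1; rewrite E in E1; lra.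
(* The sign is opposite to the orientation because the normal has radius minus [lambda] times the
   radius of the curve. *)
- exists (- s); split; [destruct Hs; [right | left]; lra |].
  intros l Hl.
  assert (E : @orientation k gamma N (mu l) = s).
  { pose proof (Hsq l Hl); pose proof (Hpos l Hl); destruct Hs as [-> | ->]; nra. }
  split; [lra |].
  unfold twist.
  rewrite (frame_cross_radius k _ _ _ (curve_frame surf normal (mu l) (mu_in l Hl))).
  rewrite (curv_lambda_radius surf (mu l) (mu_in l Hl)).
    rewrite (curv_lambda_mu l Hl).
  fold (@orientation k gamma N (mu l)); rewrite E; ring.
Qed.

Lemma is_derive_radius_mu (l : R) : I l ->
  is_derive (fun s => radius k (gamma (mu s))) l
    (Derive mu l * radius k (dvec gamma (mu l))).
Proof.
intros Hl; apply (is_derive_Rcomp (fun u => radius k (gamma u))).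
- apply is_derive_radius, is_dvec_gamma, Hl.
- now apply is_derive_mu.
Qed.

(** The twist along [mu] is differentiated twice over: by the product rule as tau l rho ([D1]), and
    by the chain rule from its [u]-derivative ([D2]). The Weingarten relation enters when the two
    are equated. *)
Lemma radius_equation (l : R) : I l ->
  2 * (H - l) * (Derive mu l * radius k (dvec gamma (mu l))) =
  radius k (gamma (mu l)).
Proof.
intros Hl.
destruct twist_lambda as [tau [Htau Htw]].
assert (D1 : is_derive (fun s => @twist k gamma (mu s)) l
  (tau * radius k (gamma (mu l))
   + tau * l * (Derive mu l * radius k (dvec gamma (mu l))))).
{ apply is_derive_ext_loc with (fun s => tau * s * radius k (gamma (mu s))).
  - apply filter_imp with I; [| now apply open_interval_locally].
    intros s Hs; symmetry; apply (Htw s Hs).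
  - apply (is_derive_Rmult (fun s => tau * s) (fun s => radius k (gamma (mu s)))).
    + auto_derive; [easy | ring].
    + now apply is_derive_radius_mu. }
pose proof (is_derive_Rcomp _ mu l _ _
  (is_derive_twist surf normal (mu l) (mu_in l Hl)) (is_derive_mu l Hl)) as D2.
apply is_derive_unique in D1; apply is_derive_unique in D2; rewrite D2 in D1.
rewrite (weingarten (mu l) 0 (mu_in l Hl) (v_range_0 k)) in D1.
rewrite (curv_lambda_mu l Hl), (proj1 (Htw l Hl)) in D1.
destruct Htau as [-> | ->]; lra.
Qed.

Lemma radius_mu_pos (l : R) : I l -> 0 < radius k (gamma (mu l)).
Proof. intros Hl; apply (proj1 (proj2 (proj2 surf)) (mu l) (mu_in l Hl)). Qed.

Lemma radius_formula :
  exists c, 0 < c /\ forall l, I l ->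
    radius k (gamma (mu l)) = c / sqrt (2 * (H - l)).
Proof.
pose (E l := 2 * (H - l) * (radius k (gamma (mu l)) * radius k (gamma (mu l)))).
assert (HE : forall l, I l -> is_derive E l 0).
{ intros l Hl; pose proof (is_derive_radius_mu l Hl) as D.
  pose proof (radius_equation l Hl) as Er.
  evar_last.
  - apply (is_derive_Rmult (fun l => 2 * (H - l))
      (fun l => radius k (gamma (mu l)) * radius k (gamma (mu l)))).
    + instantiate (1 := -2); auto_derive; [easy | ring].
    + apply is_derive_Rmult; exact D.
  - match goal with |- ?x = ?y => change (@eq R x y) end; cbn beta.
    revert Er; generalize (Derive mu l * radius k (dvec gamma (mu l)))
      (radius k (gamma (mu l))); intros d r <-; ring. }
destruct (open_interval_nonempty I HI) as [l0 Hl0].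
assert (E0 : 0 < E l0).
{ pose proof (radius_mu_pos l0 Hl0); pose proof (Hlambda l0 Hl0).
  unfold E; repeat apply Rmult_lt_0_compat; lra. }
(* [E] is constant on [I], so its value at any base point is c^2. *)
exists (sqrt (E l0)); split; [now apply sqrt_lt_R0 |].
intros l Hl.
pose proof (radius_mu_pos l Hl); pose proof (Hlambda l Hl).
rewrite <- (constant_on I E l l0 HI HE Hl Hl0); unfold E.
rewrite sqrt_mult, sqrt_square by nra.
field; apply Rgt_not_eq, sqrt_lt_R0; lra.
Qed.

(** * The speed of the parameter change and the derivative of the angle *)

Section Angle.

Context {c : R}.
Hypothesis c_pos : 0 < c.
Hypothesis Hrad : forall l, I l -> radius k (gamma (mu l)) = c / sqrt (2 * (H - l)).

Lemma radius_square (l : R) : I l ->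
  radius k (gamma (mu l)) ^ 2 = c ^ 2 / (2 * (H - l)).
Proof.
intros Hl; rewrite (Hrad l Hl); pose proof (Hlambda l Hl).
assert (sqrt (2 * (H - l)) ^ 2 = 2 * (H - l)) by (apply pow2_sqrt; lra).
assert (0 < sqrt (2 * (H - l))) by (apply sqrt_lt_R0; lra).
transitivity (c ^ 2 / sqrt (2 * (H - l)) ^ 2); [field; lra | congruence].
Qed.

Lemma radius_minus_delta (l : R) : I l ->
  radius k (gamma (mu l)) ^ 2 - delta k =
  (c ^ 2 - 2 * delta k * (H - l)) / (2 * (H - l)).
Proof.
intros Hl; rewrite (radius_square l Hl); pose proof (Hlambda l Hl); field; lra.
Qed.

(** With c^2 = 2 (H - l) rho^2, the relation D^2 = delta + rho'^2 - rho^2 turns the radicand into 2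
    (H - l) rho'^2, where the prime is d/du. The product of mu' and rho' is then known from
    [radius_equation]. *)
Lemma speed_square (l : R) : I l ->
  Derive mu l ^ 2 * ((l ^ 2 + 1) * c ^ 2 - 2 * delta k * (H - l)) =
  c ^ 2 / (2 * (H - l)) ^ 2.
Proof.
intros Hl; pose proof (Hlambda l Hl) as h.
pose proof (radius_equation l Hl) as E.
pose proof (radius_square l Hl) as R2.
pose proof (frame_cross_square k _ _ _ (curve_frame surf normal (mu l) (mu_in l Hl))) as F.
destruct twist_lambda as [tau [Htau Htw]].
fold (@twist k gamma (mu l)) in F; rewrite (proj2 (Htw l Hl)) in F.
revert R2 E F; generalize (radius k (gamma (mu l))) (radius k (dvec gamma (mu l)))
  (Derive mu l) (delta k).
intros r d m e R2 E F.
assert (F' : l ^ 2 * r ^ 2 = e + d ^ 2 - r ^ 2).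
{ rewrite <- F; destruct Htau as [-> | ->]; ring. }
assert (c2 : c ^ 2 = 2 * (H - l) * r ^ 2) by (rewrite R2; field; lra).
rewrite c2.
transitivity (2 * (H - l) * (m ^ 2 * (l ^ 2 * r ^ 2 + r ^ 2 - e))); [ring |].
rewrite F', <- E; field; lra.
Qed.

(** The common end of the three types: each only has to produce an angle whose derivative is, up to
    a constant sign, D mu' / (rho^2 - delta). *)
Lemma is_Phi_of_derive (Phi : R -> R) (s : R) :
  admissible k H c I -> (s = 1 \/ s = -1) ->
  (forall l, I l -> is_derive Phi l
     (s * (Derive mu l * @twist k gamma (mu l))
        / (radius k (gamma (mu l)) ^ 2 - delta k))) ->
  is_Phi k H c I Phi.
Proof.
intros adm Hs HPhi.
destruct (constant_sign_on I (Derive mu) HI) as [sg [Hsg Hpos]].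
- exact continuous_Derive_mu.
- intros l Hl; apply (proj1 (proj2 (proj2 param)) l Hl).
- destruct twist_lambda as [tau [Htau Htw]].
  assert (s2 : s ^ 2 = 1) by (destruct Hs as [-> | ->]; ring).
  assert (sg2 : sg ^ 2 = 1) by (destruct Hsg as [-> | ->]; ring).
  assert (tau2 : tau ^ 2 = 1) by (destruct Htau as [-> | ->]; ring).
  assert (w0 : 0 < sqrt 2) by (apply sqrt_lt_R0; lra).
  (* The sign collects those of the angle, of mu' and of the normal. The constant is 0 because the
     antiderivative is taken to be a rescaled [Phi], which already contains it. *)
  exists 0, (s * sg * tau), (fun l => s * sg * tau * (sqrt 2 / c ^ 2) * Phi l).
  split; [| split].
  + destruct Hs as [-> | ->], Hsg as [-> | ->], Htau as [-> | ->]; lra.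
  + intros l Hl; destruct (adm l Hl) as [A1 A2].
    pose proof (Hlambda l Hl) as h; pose proof (Hpos l Hl) as mpos.
    evar_last; [apply (is_derive_scal Phi), HPhi, Hl |].
    match goal with |- ?x = ?y => change (@eq R x y) end.
    rewrite (radius_minus_delta l Hl), (proj2 (Htw l Hl)), (Hrad l Hl).
    unfold Phi_integrand.
    rewrite sqrt_mult by lra.
    pose proof (speed_square l Hl) as M.
    assert (h0 : 0 < sqrt (H - l)) by now apply sqrt_lt_R0.
    assert (h1 : sqrt (H - l) ^ 2 = H - l) by (apply pow2_sqrt; lra).
    set (A := (l ^ 2 + 1) * c ^ 2 - 2 * delta k * (H - l)) in *.
    set (B := c ^ 2 - 2 * delta k * (H - l)) in *.
    assert (a0 : 0 < sqrt A) by now apply sqrt_lt_R0.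
    assert (a1 : sqrt A ^ 2 = A) by (apply pow2_sqrt; lra).
    (* [sg * Derive mu l] is the absolute value of mu', so it is the positive root of
       [speed_square]. *)
    assert (m1 : sg * Derive mu l = c / (2 * (H - l) * sqrt A)).
    { apply Rsqr_inj; [lra | |].
      - apply Rlt_le, Rdiv_lt_0_compat; [lra |].
        apply Rmult_lt_0_compat; lra.
      - unfold Rsqr; transitivity (sg ^ 2 * (Derive mu l ^ 2 * A) / A); [field; lra |].
        rewrite M, sg2; transitivity (c ^ 2 / ((2 * (H - l)) ^ 2 * sqrt A ^ 2));
          [rewrite a1 |]; field; repeat split; lra. }
    transitivity (s ^ 2 * tau ^ 2 * (sg * Derive mu l)
      * (sqrt 2 / c ^ 2 * l * (c / (sqrt 2 * sqrt (H - l))) / (B / (2 * (H - l)))));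
      [field; repeat split; lra |].
    rewrite s2, tau2, m1; field; repeat split; lra.
  + intros l Hl.
    transitivity (s ^ 2 * sg ^ 2 * tau ^ 2 * Phi l); [rewrite s2, sg2, tau2; ring |].
    field; split; lra.
Qed.

End Angle.

End Reparameterization.

(** * The three types *)

(** Multiplied by c^2, the radicand becomes (c^2 l + 1)^2 - (1 + 2 H c^2 - c^4). The bound on [H]
    makes the subtracted term positive, so [l] lies outside the interval between the two roots. *)
Lemma spherical_ranges (H c l : R) :
  0 < c -> 0 < (l ^ 2 + 1) * c ^ 2 - 2 * (H - l) ->
  H > 1 / 2 * (c ^ 2 - 1 / c ^ 2) ->
  l < (- 1 - sqrt (1 + 2 * H * c ^ 2 - c ^ 4)) / c ^ 2 \/
  (- 1 + sqrt (1 + 2 * H * c ^ 2 - c ^ 4)) / c ^ 2 < l.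
Proof.
intros c0 A HH.
assert (c2 : 0 < c ^ 2) by now apply pow_lt.
assert (D0 : 0 <= 1 + 2 * H * c ^ 2 - c ^ 4).
{ assert (E : 1 / c ^ 2 * c ^ 2 = 1) by (field; lra).
  replace (c ^ 4) with (c ^ 2 * c ^ 2) by ring; nra. }
pose proof (sqrt_pos (1 + 2 * H * c ^ 2 - c ^ 4)) as d0.
pose proof (pow2_sqrt _ D0) as d2.
set (d := sqrt (1 + 2 * H * c ^ 2 - c ^ 4)) in *.
assert (F : d ^ 2 < (c ^ 2 * l + 1) ^ 2).
{ rewrite d2.
  assert (0 < c ^ 2 * ((l ^ 2 + 1) * c ^ 2 - 2 * (H - l))) by now apply Rmult_lt_0_compat.
  replace (c ^ 4) with (c ^ 2 * c ^ 2) by ring; lra. }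
destruct (Rlt_le_dec (c ^ 2 * l + 1) 0) as [neg | pos].
- left; apply Rmult_lt_reg_r with (c ^ 2); [exact c2 |].
  replace ((-1 - d) / c ^ 2 * c ^ 2) with (-1 - d) by (field; lra); nra.
- right; apply Rmult_lt_reg_r with (c ^ 2); [exact c2 |].
  replace ((-1 + d) / c ^ 2 * c ^ 2) with (-1 + d) by (field; lra); nra.
Qed.

Lemma spherical_profile (H c : R) (J I : R -> Prop) (gamma : R -> E4)
    (N : R -> R -> E4) (mu : R -> R)
    (surf : rotational_surface Spherical (-1) J gamma)
    (normal : unit_normal_field Spherical (-1) J gamma N)
    (weingarten : forall u v, J u -> v_range Spherical v ->
       curv_kappa Spherical gamma N u v = curv_lambda Spherical gamma N u v - 2 * H)
    (param : parameterized_by_lambda Spherical J I gamma N mu)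
    (Hlambda : forall l, I l -> 0 < H - l) (c_pos : 0 < c)
    (Hrad : forall l, I l ->
       radius Spherical (gamma (mu l)) = c / sqrt (2 * (H - l)))
    (adm : admissible Spherical H c I) :
  exists Phi : R -> R, is_Phi Spherical H c I Phi /\
    (spherical_case_a H c I Phi (fun l => gamma (mu l)) \/
     spherical_case_b H c I Phi (fun l => gamma (mu l))).
Proof.
pose proof (proj1 param) as HI.
assert (Hmodel : forall l, I l ->
  x3 (gamma (mu l)) ^ 2 - x4 (gamma (mu l)) ^ 2 = 1 - x2 (gamma (mu l)) ^ 2).
{ intros l Hl.
  destruct (proj1 (proj2 (proj2 surf)) (mu l) (mu_in param l Hl)) as (E1 & _ & E2 & _).
  unfold in_dS3 in E2; simpl in E1, E2; rewrite E1 in E2; lra. }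
assert (HZ : forall l, I l -> is_derive (fun s => x3 (gamma (mu s))) l
  (Derive mu l * x3 (dvec gamma (mu l)))).
{ intros l Hl; apply (is_dvec_gamma_mu surf param l Hl). }
assert (HW : forall l, I l -> is_derive (fun s => x4 (gamma (mu s))) l
  (Derive mu l * x4 (dvec gamma (mu l)))).
{ intros l Hl; apply (is_dvec_gamma_mu surf param l Hl). }
pose proof (fun l Hl => radius_minus_delta Hlambda Hrad l Hl) as Hdelta.
(* This factor has the sign of y^2 - 1, which decides between the cases: positive gives (b),
   negative gives (a). *)
destruct (constant_sign_on I (fun l => c ^ 2 - 2 * delta Spherical * (H - l)) HI)
  as [e [He Hsign]].
{ intros l Hl; apply (ex_derive_continuous (K := R_AbsRing) (V := R_NormedModule)).
  auto_derive; easy. }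
{ intros l Hl; apply (adm l Hl). }
simpl in Hdelta, Hsign.
destruct He as [-> | ->].
- assert (Hpos : forall l, I l -> 0 < x4 (gamma (mu l)) ^ 2 - x3 (gamma (mu l)) ^ 2).
  { intros l Hl; pose proof (Hmodel l Hl) as M; pose proof (Hdelta l Hl) as E.
    assert (0 < (c ^ 2 - 2 * 1 * (H - l)) / (2 * (H - l))).
    { pose proof (Hsign l Hl); pose proof (Hlambda l Hl).
      apply Rdiv_lt_0_compat; lra. }
    lra. }
  (* Here w^2 > z^2, so w takes the role of the hyperbolic cosine coordinate. *)
  destruct (hyperbolic_angle I _ _ _ _ HI HW HZ Hpos) as (Phi & s & Hs & HPhi).
  exists Phi; split; [| right; split].
  (* The sign is reversed because the twist is z w' - w z', the opposite of the numerator of the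
     angle. *)
  + apply (is_Phi_of_derive surf normal weingarten param Hlambda c_pos Hrad Phi (- s) adm).
    * destruct Hs; [right | left]; lra.
    * intros l Hl; destruct (HPhi l Hl) as [D _].
      evar_last; [exact D |]; unfold twist; cbn [radius cross delta x1 x2 x3 x4].
      pose proof (Hmodel l Hl); pose proof (Hpos l Hl).
      replace (x2 (gamma (mu l)) ^ 2 - 1)
        with (x4 (gamma (mu l)) ^ 2 - x3 (gamma (mu l)) ^ 2) by lra.
      field; lra.
  + exists s; split; [exact Hs |]; intros l Hl.
    destruct (HPhi l Hl) as (_ & EW & EZ); pose proof (Hmodel l Hl) as M.
    replace (x4 (gamma (mu l)) ^ 2 - x3 (gamma (mu l)) ^ 2)
      with (x2 (gamma (mu l)) ^ 2 - 1) in EW, EZ by lra.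
    split; [apply (Hrad l Hl) | split; assumption].
  + intros l Hl; pose proof (Hsign l Hl); pose proof (Hlambda l Hl); lra.
- assert (Hpos : forall l, I l -> 0 < x3 (gamma (mu l)) ^ 2 - x4 (gamma (mu l)) ^ 2).
  { intros l Hl; pose proof (Hmodel l Hl) as M; pose proof (Hdelta l Hl) as E.
    assert (0 < (2 * 1 * (H - l) - c ^ 2) / (2 * (H - l))).
    { pose proof (Hsign l Hl); pose proof (Hlambda l Hl).
      apply Rdiv_lt_0_compat; lra. }
    replace ((2 * 1 * (H - l) - c ^ 2) / (2 * (H - l)))
      with (- ((c ^ 2 - 2 * 1 * (H - l)) / (2 * (H - l)))) in H0
      by (pose proof (Hlambda l Hl); field; lra).
    lra. }
  destruct (hyperbolic_angle I _ _ _ _ HI HZ HW Hpos) as (Phi & s & Hs & HPhi).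
  exists Phi; split; [| left; split].
  (* Now the numerator agrees with the twist, but the denominator z^2 - w^2 is the opposite of y^2 -
     1. *)
  + apply (is_Phi_of_derive surf normal weingarten param Hlambda c_pos Hrad Phi (- s) adm).
    * destruct Hs; [right | left]; lra.
    * intros l Hl; destruct (HPhi l Hl) as [D _].
      evar_last; [exact D |]; unfold twist; cbn [radius cross delta x1 x2 x3 x4].
      pose proof (Hmodel l Hl); pose proof (Hpos l Hl).
      replace (x2 (gamma (mu l)) ^ 2 - 1)
        with (- (x3 (gamma (mu l)) ^ 2 - x4 (gamma (mu l)) ^ 2)) by lra.
      field; lra.
  + exists s; split; [exact Hs |]; intros l Hl.
    destruct (HPhi l Hl) as (_ & EZ & EW).
    rewrite (Hmodel l Hl) in EZ, EW.
    split; [apply (Hrad l Hl) | split; assumption].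
  + assert (Hlt : forall l, I l -> l < H - c ^ 2 / 2).
    { intros l Hl; pose proof (Hsign l Hl); lra. }
    destruct (Rlt_le_dec (1 / 2 * (c ^ 2 - 1 / c ^ 2)) H) as [Hgt | Hle].
    * left; split; [exact Hgt |]; intros l Hl.
      destruct (adm l Hl) as [_ A]; simpl in A.
      destruct (spherical_ranges H c l c_pos) as [h | h]; auto.
      simpl; lra.
    * right; split; assumption.
Qed.

Lemma hyperbolic_profile (H c : R) (J I : R -> Prop) (gamma : R -> E4)
    (N : R -> R -> E4) (mu : R -> R)
    (surf : rotational_surface Hyperbolic (-1) J gamma)
    (normal : unit_normal_field Hyperbolic (-1) J gamma N)
    (weingarten : forall u v, J u -> v_range Hyperbolic v ->
       curv_kappa Hyperbolic gamma N u v = curv_lambda Hyperbolic gamma N u v - 2 * H)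
    (param : parameterized_by_lambda Hyperbolic J I gamma N mu)
    (Hlambda : forall l, I l -> 0 < H - l) (c_pos : 0 < c)
    (Hrad : forall l, I l ->
       radius Hyperbolic (gamma (mu l)) = c / sqrt (2 * (H - l)))
    (adm : admissible Hyperbolic H c I) :
  exists Phi : R -> R, is_Phi Hyperbolic H c I Phi /\
    hyperbolic_case H c I Phi (fun l => gamma (mu l)).
Proof.
pose proof (proj1 param) as HI.
assert (Hmodel : forall l, I l ->
  x1 (gamma (mu l)) ^ 2 + x2 (gamma (mu l)) ^ 2 = 1 + x4 (gamma (mu l)) ^ 2).
{ intros l Hl.
  destruct (proj1 (proj2 (proj2 surf)) (mu l) (mu_in param l Hl)) as (E1 & _ & E2 & _).
  unfold in_dS3 in E2; simpl in E1, E2; rewrite E1 in E2; lra. }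
assert (HX : forall l, I l -> is_derive (fun s => x1 (gamma (mu s))) l
  (Derive mu l * x1 (dvec gamma (mu l)))).
{ intros l Hl; apply (is_dvec_gamma_mu surf param l Hl). }
assert (HY : forall l, I l -> is_derive (fun s => x2 (gamma (mu s))) l
  (Derive mu l * x2 (dvec gamma (mu l)))).
{ intros l Hl; apply (is_dvec_gamma_mu surf param l Hl). }
assert (Hpos : forall l, I l -> 0 < x1 (gamma (mu l)) ^ 2 + x2 (gamma (mu l)) ^ 2).
{ intros l Hl; rewrite (Hmodel l Hl); nra. }
destruct (circular_angle I _ _ _ _ HI HX HY) as [Phi HPhi]; [| exact Hpos |].
{ intros l Hl.
  (* The numerator of the angular velocity is mu' times the twist, and the twist is
     differentiable. *)
  apply continuous_ext with (fun s => Derive mu s * @twist Hyperbolic gamma (mu s)).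
  - intros s; unfold twist; simpl; ring.
  - apply (continuous_mult (K := R_AbsRing)).
    + now apply (continuous_Derive_mu param).
    + eapply is_derive_continuous, is_derive_Rcomp.
      * apply (is_derive_twist surf normal), (mu_in param l Hl).
      * exact (is_derive_mu param l Hl). }
exists Phi; split.
- apply (is_Phi_of_derive surf normal weingarten param Hlambda c_pos Hrad Phi 1 adm); [now left |].
  intros l Hl; destruct (HPhi l Hl) as [D _].
  evar_last; [exact D |]; unfold twist; cbn [radius cross delta x1 x2 x3 x4].
  pose proof (Hmodel l Hl); pose proof (Hpos l Hl).
  replace (x4 (gamma (mu l)) ^ 2 - -1)
    with (x1 (gamma (mu l)) ^ 2 + x2 (gamma (mu l)) ^ 2) by lra.
  field; lra.
- intros l Hl; destruct (HPhi l Hl) as (_ & EX & EY).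
  rewrite (Hmodel l Hl) in EX, EY; pose proof (Hlambda l Hl).
  split; [apply (Hrad l Hl) | repeat split]; auto; lra.
Qed.

Lemma parabolic_profile (H c : R) (J I : R -> Prop) (gamma : R -> E4)
    (N : R -> R -> E4) (mu : R -> R)
    (surf : rotational_surface Parabolic (-1) J gamma)
    (normal : unit_normal_field Parabolic (-1) J gamma N)
    (weingarten : forall u v, J u -> v_range Parabolic v ->
       curv_kappa Parabolic gamma N u v = curv_lambda Parabolic gamma N u v - 2 * H)
    (param : parameterized_by_lambda Parabolic J I gamma N mu)
    (Hlambda : forall l, I l -> 0 < H - l) (c_pos : 0 < c)
    (Hrad : forall l, I l ->
       radius Parabolic (gamma (mu l)) = c / sqrt (2 * (H - l)))
    (adm : admissible Parabolic H c I) :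
  exists Phi : R -> R, is_Phi Parabolic H c I Phi /\
    parabolic_case H c I Phi (fun l => gamma (mu l)).
Proof.
assert (Hpos : forall l, I l -> 0 < x3 (gamma (mu l))).
{ intros l Hl; apply (radius_mu_pos surf param l Hl). }
exists (fun l => x1 (gamma (mu l)) / x3 (gamma (mu l))); split.
- apply (is_Phi_of_derive surf normal weingarten param Hlambda c_pos Hrad _ 1 adm); [now left |].
  intros l Hl; pose proof (Hpos l Hl).
  destruct (is_dvec_gamma_mu surf param l Hl) as (D1 & _ & D3 & _).
  evar_last.
  + apply is_derive_div; [exact D1 | exact D3 | lra].
  + unfold twist; simpl; field; lra.
- intros l Hl; pose proof (Hpos l Hl); pose proof (Hlambda l Hl).
  destruct (proj1 (proj2 (proj2 surf)) (mu l) (mu_in param l Hl)) as (E1 & _ & E2 & _).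
  unfold in_dS3 in E2; simpl in E1, E2; rewrite E1 in E2.
  split; [apply (Hrad l Hl) | repeat split].
  + field; lra.
  + apply Rmult_eq_reg_r with (2 * x3 (gamma (mu l))); [field_simplify; lra | lra].
  + lra.
Qed.

Theorem corollary3p3 (k : rotation_type) (H : R) (J I : R -> Prop)
  (gamma : R -> E4) (N : R -> R -> E4) (mu : R -> R)
  (surf : rotational_surface k (-1) J gamma)
  (normal : unit_normal_field k (-1) J gamma N)
  (weingarten : forall u v, J u -> v_range k v ->
     curv_kappa k gamma N u v = curv_lambda k gamma N u v - 2 * H)
  (param : parameterized_by_lambda k J I gamma N mu)
  (Hlambda : forall l, I l -> 0 < H - l) :
  (forall u v, J u -> v_range k v -> mean_curvature k (-1) gamma N u v = H) /\
  exists c : R, 0 < c /\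
    (forall l, I l -> radius k (gamma (mu l)) = c / sqrt (2 * (H - l))) /\
    (admissible k H c I ->
     exists Phi : R -> R, is_Phi k H c I Phi /\
       let profile l := gamma (mu l) in
       match k with
       | Spherical =>
           spherical_case_a H c I Phi profile \/
           spherical_case_b H c I Phi profile
       | Hyperbolic => hyperbolic_case H c I Phi profile
       | Parabolic => parabolic_case H c I Phi profile
       end).
Proof.
split.
- intros u v Hu Hv; unfold mean_curvature; rewrite (weingarten u v Hu Hv); field.
- destruct (radius_formula surf normal weingarten param Hlambda) as (c & c_pos & Hrad).
  exists c; split; [exact c_pos | split; [exact Hrad |]]; intros adm.
  destruct k.
  + apply (spherical_profile H c J I gamma N mu); assumption.
  + apply (hyperbolic_profile H c J I gamma N mu); assumption.
  + apply (parabolic_profile H c J I gamma N mu); assumption.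
Qed.
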